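(* Let $f=f(\mathbf{x},\mathbf{v},t)$ be a real-valued continuously differentiable function on $\mathbb{R}^n\times\mathbb{R}^n\times[0,1]$, and let boundary values $\mathbf{x}(0),\mathbf{x}(1)\in\mathbb{R}^n$ be specified. Suppose that the Euler--Lagrange equations provide a global minimum of $$J(\mathbf{x})=\int_0^1 f(\mathbf{x},\dot{\mathbf{x}},t)\,dt$$ with these boundary conditions; that is, there is an admissible curve $\mathbf{x}^*$ with the specified boundary values that satisfies $$\frac{\partial f}{\partial\mathbf{x}}-\frac{d}{dt}\left(\frac{\partial f}{\partial\dot{\mathbf{x}}}\right)=\mathbf{0}$$ and satisfies $J(\mathbf{x}^* )\le J(\mathbf{x})$ for all admissible curves $\mathbf{x}$ with the same boundary values. Let $A(\mathbf{x})=[A_{ij}(\mathbf{x})]$ be any differentiable $m\times n$ matrix-valued function of $\mathbf{x}\in\mathbb{R}^n$ satisfying $$\frac{\partial A_{ji}}{\partial x_k}=\frac{\partial A_{jk}}{\partial x_i}\qquad\text{for all } 1\le j\le m,\ 1\le i,k\le n,$$ and let $W=W(t)$, $t\in[0,1]$, be any differentiable function with values in the symmetric positive definite $m\times m$ matrices. For $\mathbf{s}\in\mathbb{R}^m$ put $\mathbf{q}=[\mathbf{x}^T,\mathbf{s}^T]^T\in\mathbb{R}^{n+m}$ and $$\phi(\mathbf{q},\dot{\mathbf{q}},t)=f(\mathbf{x},\dot{\mathbf{x}},t)+\tfrac12\,\|\dot{\mathbf{s}}-A(\mathbf{x})\dot{\mathbf{x}}\|_{W(t)}^2 .$$ Then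 the variational problem of minimizing $\int_0^1\phi(\mathbf{q},\dot{\mathbf{q}},t)\,dt$ over admissible curves $\mathbf{q}$ with specified boundary conditions $\mathbf{q}(0)=[\mathbf{x}(0)^T,\mathbf{s}(0)^T]^T$ and $\mathbf{q}(1)=[\mathbf{x}(1)^T,\mathbf{s}(1)^T]^T$, where $\mathbf{s}(0),\mathbf{s}(1)\in\mathbb{R}^m$ are arbitrary specified vectors, has a globally optimal solution (a global minimizer).
   Context: A dot denotes $d/dt$. Admissible curves are continuously differentiable curves on $[0,1]$ (with values in $\mathbb{R}^n$ for $\mathbf{x}$, in $\mathbb{R}^{n+m}$ for $\mathbf{q}$). Derivatives with respect to vectors are gradients. For a symmetric positive definite $m\times m$ matrix $W$, $\|\mathbf{s}\|_W=(\mathbf{s}^TW\mathbf{s})^{1/2}$ is the weighted Euclidean norm on $\mathbb{R}^m$. *)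

(* Defs.v *)
From HB Require Import structures.
From mathcomp Require Import all_boot all_order all_algebra.
From mathcomp Require Import all_classical all_reals all_analysis.

Set Implicit Arguments.
Unset Strict Implicit.
Unset Printing Implicit Defensive.

Import Order.TTheory GRing.Theory Num.Theory.
Import numFieldNormedType.Exports.

Local Open Scope classical_set_scope.
Local Open Scope ring_scope.

Section RelativeDerivative.
Context {R : realType} {V : normedModType R}.

(* The difference quotient of g at t, with increments h != 0 such that t + h
   stays in D; for D = [0, 1] its limit is the ordinary derivative inside ]0, 1[
   and the one-sided derivative at 0 and at 1. *)
Definition diff_quotient_in (D : set R) (g : R -> V) (t : R) : set_system V :=
  (fun h : R => h^-1 *: (g (t + h) - g t)) @
    within [set h : R | D (t + h)] (0 : R)^'.

Definition derivable_in (D : set R) (g : R -> V) (t : R) : Prop :=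
  cvg (diff_quotient_in D g t).

Definition derive_in (D : set R) (g : R -> V) (t : R) : V :=
  lim (diff_quotient_in D g t).

End RelativeDerivative.

Section CalculusOfVariations.
Context {R : realType}.

Definition I01 : set R := [set` `[0, 1]].

Definition grad n (g : 'cV[R]_n -> R) (x : 'cV[R]_n) : 'cV[R]_n :=
  \col_i 'D_(delta_mx i 0) g x.

(* Curves are total functions on R; only their values on [0, 1] matter. *)
Definition admissible n (x : R -> 'cV[R]_n) : Prop :=
  (forall t, I01 t -> derivable_in I01 x t) /\
  {within I01, continuous (derive_in I01 x)}.

(* L x v t, the velocity v standing for the time derivative of x. *)
Definition lagrangian n := 'cV[R]_n -> 'cV[R]_n -> R -> R.

Definition lagrangian_dom n : set ('cV[R]_n * 'cV[R]_n * R) := setT `*` I01.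
Arguments lagrangian_dom n : clear implicits.

(* Continuous differentiability on R^n x R^n x [0, 1]: L is continuous, and its
   first partial derivatives exist and are jointly continuous; at t = 0 and
   t = 1 the partial derivative in t is one-sided. *)
Definition C1_lagrangian n (L : lagrangian n) : Prop :=
  [/\ {within lagrangian_dom n, continuous (fun p => L p.1.1 p.1.2 p.2)},
      (forall x v t, I01 t ->
         [/\ forall i, derivable (fun y => L y v t) x (delta_mx i 0),
             forall i, derivable (fun w => L x w t) v (delta_mx i 0) &
             derivable_in I01 (L x v : R -> R^o) t]),
      {within lagrangian_dom n, continuous
         (fun p => grad (fun y => L y p.1.2 p.2) p.1.1)},
      {within lagrangian_dom n, continuous
         (fun p => grad (fun w => L p.1.1 w p.2) p.1.2)} &
      {within lagrangian_dom n, continuous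
         (fun p => derive_in I01 (L p.1.1 p.1.2 : R -> R^o) p.2)}].

Definition action n (L : lagrangian n) (x : R -> 'cV[R]_n) : R :=
  Rintegral lebesgue_measure I01 (fun t => L (x t) (derive_in I01 x t) t).

Definition euler_lagrange n (L : lagrangian n) (x : R -> 'cV[R]_n) : Prop :=
  let dLdv t := grad (fun w => L (x t) w t) (derive_in I01 x t) in
  forall t, I01 t ->
    derivable_in I01 dLdv t /\
    grad (fun y => L y (derive_in I01 x t) t) (x t) - derive_in I01 dLdv t = 0.

Definition global_minimizer n (L : lagrangian n) (a b : 'cV[R]_n)
    (x : R -> 'cV[R]_n) : Prop :=
  [/\ admissible x, x 0 = a, x 1 = b &
      forall y, admissible y -> y 0 = a -> y 1 = b -> action L x <= action L y].

Definition spd_mx m (M : 'M[R]_m) : Prop :=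
  M^T = M /\ forall s : 'cV[R]_m, s != 0 -> 0 < (s^T *m M *m s) 0 0.

Definition wnorm m (M : 'M[R]_m) (s : 'cV[R]_m) : R :=
  Num.sqrt ((s^T *m M *m s) 0 0).

(* q = col_mx x s, so that usubmx q = x and dsubmx q = s. *)
Definition augmented n m (f : lagrangian n) (A : 'cV[R]_n -> 'M[R]_(m, n))
    (W : R -> 'M[R]_m) : lagrangian (n + m) := fun q dq t =>
  f (usubmx q) (usubmx dq) t
    + 2^-1 * wnorm (W t) (dsubmx dq - A (usubmx q) *m usubmx dq) ^+ 2.

End CalculusOfVariations.

(* Main.v *)
Require Import Defs.
From HB Require Import structures.
From mathcomp Require Import all_boot all_order all_algebra.
From mathcomp Require Import all_classical all_reals all_analysis.
From mathcomp Require Import ring lra.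

Set Implicit Arguments.
Unset Strict Implicit.
Unset Printing Implicit Defensive.

Import Order.TTheory GRing.Theory Num.Theory.
Import numFieldNormedType.Exports.

Local Open Scope classical_set_scope.
Local Open Scope ring_scope.

(** Write the penalty with a potential. The rows of [A] are closed
    differentiable forms, hence exact: there is [S] such that, along every
    curve, [S (x t)] has derivative [A (x t) *m x' t]. In the coordinate [r
    = s - S x] the penalty becomes the kinetic energy [2^-1 * wnorm (W t)
    (r' t) ^+ 2], which no longer involves [x], and the boundary values of
    [r] are fixed by those of [x] and [s]. The problem therefore splits: the
    first part is minimized by the given curve [xs], and the second by the
    curve [r] whose momentum [W t *m r' t] is constant. With [r] normalized
    to start at 0, the minimizer is [col_mx xs (S xs + r + (s0 - S x0))].

    Two points need care. The partial derivatives of [A] need not be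
    continuous, so the potential cannot be differentiated under the integral
    sign; instead, the integral of each row over a triangle vanishes by
    Goursat's subdivision argument ([corner_triangle_eq0]), and the
    potential is the integral along segments from the origin
    ([closed_form_has_potential]). The mean value theorem along a segment
    then yields the chain rule along curves ([has_deriv01_potential]).

    The constant-momentum curve exists because the integral of [invmx (W t)]
    over [0, 1] is invertible ([constant_momentum_curve]); it is optimal
    because the squared norm lies above its tangent ([sqr_wnorm_tangent]),
    and the integral of the tangent term is [c] applied to the difference
    between the increments over [0, 1] of a competitor's [s - S x] and of
    [r], which are equal. *)

(** * Limits and norms of matrices *)

Lemma cvg_mx_entries (R : realType) (T : Type) (F : set_system T)
    (FF : Filter F) (p q : nat) (f : T -> 'M[R]_(p, q)) (v : 'M[R]_(p, q)) :
  (forall i j, (fun x => f x i j) @ F --> v i j) -> f @ F --> v.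
Proof.
move=> fv; apply/cvg_ballP => e e0.
have h : \forall x \near F, forall i j, ball (v i j) e (f x i j).
  apply: filter_forall => i; apply: filter_forall => j.
  by move/cvg_ballP: (fv i j) => /(_ _ e0).
by apply: filterS h => x hx; split.
Qed.

Lemma cvg_mx_entry (R : realType) (T : Type) (F : set_system T)
    (FF : Filter F) (p q : nat) (f : T -> 'M[R]_(p, q)) (v : 'M[R]_(p, q)) i j :
  f @ F --> v -> (fun x => f x i j) @ F --> v i j.
Proof.
move=> fv; apply: (@cvg_comp _ _ _ f (fun M : 'M[R]_(p, q) => M i j) F (nbhs v)).
  exact: fv.
exact: coord_continuous.
Qed.

Lemma cvg_mulmx (R : realType) (T : Type) (F : set_system T) (FF : Filter F)
    p q r (f : T -> 'M[R]_(p, q)) (g : T -> 'M[R]_(q, r))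
    (u : 'M[R]_(p, q)) (v : 'M[R]_(q, r)) :
  f @ F --> u -> g @ F --> v -> (fun x => f x *m g x) @ F --> u *m v.
Proof.
move=> fu gv; apply: cvg_mx_entries => i j; rewrite mxE.
under eq_fun do rewrite mxE.
apply: cvg_big => [|k _]; first exact: add_continuous.
by apply: cvgM; exact: cvg_mx_entry.
Qed.

Lemma cvg_det (R : realType) (T : Type) (F : set_system T) (FF : Filter F)
    p (f : T -> 'M[R]_p) (M : 'M[R]_p) :
  f @ F --> M -> (fun x => \det (f x)) @ F --> \det M.
Proof.
move=> fM; rewrite /determinant.
apply: cvg_big => [|s _]; first exact: add_continuous.
apply: cvgM; first exact: cvg_cst.
apply: cvg_big => [|i _]; first exact: mul_continuous.
exact: cvg_mx_entry.
Qed.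

(** Cramer's formula makes the inverse a rational function of the entries. *)
Lemma cvg_invmx (R : realType) (T : Type) (F : set_system T) (FF : Filter F)
    p (f : T -> 'M[R]_p) (M : 'M[R]_p) :
  M \in unitmx -> (\forall x \near F, f x \in unitmx) ->
  f @ F --> M -> (fun x => invmx (f x)) @ F --> invmx M.
Proof.
move=> Mu fu fM.
have : (fun x => (\det (f x))^-1 *: \adj (f x)) @ F --> invmx M.
  rewrite /invmx Mu; apply: cvgZ.
    by apply: cvgV; [rewrite -unitfE -unitmxE|exact: cvg_det].
  apply: cvg_mx_entries => i j; rewrite mxE; under eq_fun do rewrite mxE.
  apply: cvgM; first exact: cvg_cst.
  apply: cvg_det; apply: cvg_mx_entries => k l; rewrite !mxE.
  by under eq_fun do rewrite !mxE; exact: cvg_mx_entry.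
apply: cvg_trans; apply: near_eq_cvg; apply: filterS fu => x xu.
by rewrite /invmx xu.
Qed.

Lemma row_continuous (R : realType) n m (A : 'cV[R]_n -> 'M[R]_(m, n)) j :
  continuous A -> continuous (fun x => row j (A x)).
Proof.
move=> cA x; apply: (cvg_mx_entries (nbhs_filter x)) => i k; rewrite mxE.
under eq_fun do rewrite mxE.
by apply: (cvg_mx_entry (nbhs_filter x)); exact: cA.
Qed.

Lemma mx_entry_le_norm (R : realType) p q (M : 'M[R]_(p, q)) i j :
  `|M i j| <= `|M|.
Proof.
rewrite [`|M|]mx_normrE.
exact: (@le_bigmax _ _ _ 0 (fun k : 'I_p * 'I_q => `|M k.1 k.2|) (i, j)).
Qed.

Lemma mx_norm_le (R : realType) p q (M : 'M[R]_(p, q)) (e : R) : 0 <= e ->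
  (forall i j, `|M i j| <= e) -> `|M| <= e.
Proof. by move=> e0 Me; rewrite [`|M|]mx_normrE; apply: bigmax_le => // -[i j] _. Qed.

Lemma norm_pairing_le (R : realType) n (u : 'rV[R]_n) (v : 'cV[R]_n) :
  `|(u *m v) 0 0| <= n%:R * (`|u| * `|v|).
Proof.
rewrite mxE (le_trans (ler_norm_sum _ _ _))//.
have h (k : 'I_n) : true -> `|u 0 k * v k 0| <= `|u| * `|v|.
  by rewrite normrM => _; apply: ler_pM => //; exact: mx_entry_le_norm.
by apply: (le_trans (ler_sum _ h)); rewrite sumr_const card_ord mulr_natl.
Qed.

(** * Continuity on the unit interval *)

Lemma within_cvg (R : realType) (T : topologicalType) (f : R -> T) :
  (forall t, I01 t -> f @ within I01 (nbhs t) --> f t) <->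
  {within I01, continuous f}.
Proof. by rewrite subspace_continuousP. Qed.

Lemma within_mx_entries (R : realType) (T : topologicalType) (D : set T)
    (p q : nat) (f : T -> 'M[R]_(p, q)) :
  {within D, continuous f} <->
  (forall i j, {within D, continuous (fun x => f x i j)}).
Proof.
split=> [/subspace_continuousP fc i j|fc]; apply/subspace_continuousP => x Dx.
  by apply: cvg_mx_entry; exact: fc.
by apply: cvg_mx_entries => i j; move/subspace_continuousP: (fc i j); apply.
Qed.

Lemma withinD (R : realType) (V : normedModType R) (f g : R -> V) :
  {within I01, continuous f} -> {within I01, continuous g} ->
  {within I01, continuous (fun t => f t + g t)}.
Proof.
move=> /within_cvg cf /within_cvg cg; apply/within_cvg => t It.
by apply: cvgD; [exact: cf|exact: cg].
Qed.

Lemma withinB (R : realType) (V : normedModType R) (f g : R -> V) :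
  {within I01, continuous f} -> {within I01, continuous g} ->
  {within I01, continuous (fun t => f t - g t)}.
Proof.
move=> /within_cvg cf /within_cvg cg; apply/within_cvg => t It.
by apply: cvgB; [exact: cf|exact: cg].
Qed.

Lemma within_mulmx (R : realType) p q r (f : R -> 'M[R]_(p, q))
    (g : R -> 'M[R]_(q, r)) :
  {within I01, continuous f} -> {within I01, continuous g} ->
  {within I01, continuous (fun t => f t *m g t)}.
Proof.
move=> /within_cvg cf /within_cvg cg; apply/within_cvg => t It.
by apply: cvg_mulmx; [exact: cf|exact: cg].
Qed.

Lemma within_col_mx (R : realType) n m (x : R -> 'cV[R]_n) (s : R -> 'cV[R]_m) :
  {within I01, continuous x} -> {within I01, continuous s} ->
  {within I01, continuous (fun t => col_mx (x t) (s t))}.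
Proof.
move=> /within_mx_entries cx /within_mx_entries cs; apply/within_mx_entries => i j.
case: (split_ordP i) => k ->.
  by under eq_fun do rewrite col_mxEu; exact: cx.
by under eq_fun do rewrite col_mxEd; exact: cs.
Qed.

Lemma within_usubmx (R : realType) n m (q : R -> 'cV[R]_(n + m)) :
  {within I01, continuous q} -> {within I01, continuous (fun t => usubmx (q t))}.
Proof.
move=> /within_mx_entries cq; apply/within_mx_entries => i j.
by under eq_fun do rewrite mxE; exact: cq.
Qed.

Lemma within_dsubmx (R : realType) n m (q : R -> 'cV[R]_(n + m)) :
  {within I01, continuous q} -> {within I01, continuous (fun t => dsubmx (q t))}.
Proof.
move=> /within_mx_entries cq; apply/within_mx_entries => i j.
by under eq_fun do rewrite mxE; exact: cq.
Qed.

Lemma within_quadratic (R : realType) m (M : R -> 'M[R]_m) (s : R -> 'cV[R]_m) :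
  {within I01, continuous M} -> {within I01, continuous s} ->
  {within I01, continuous (fun t => ((s t)^T *m M t *m s t) 0 0)}.
Proof.
move=> cM cs; have csT : {within I01, continuous (fun t => (s t)^T)}.
  apply/within_mx_entries => i j; under eq_fun do rewrite mxE.
  by move/within_mx_entries: cs; apply.
have := within_mulmx (within_mulmx csT cM) cs.
by move=> /within_mx_entries /(_ 0 0).
Qed.

Lemma invmx_within_continuous (R : realType) m (W : R -> 'M[R]_m) :
  {within I01, continuous W} -> (forall t, I01 t -> W t \in unitmx) ->
  {within I01, continuous (fun t => invmx (W t))}.
Proof.
move=> /within_cvg cW Wu; apply/within_cvg => t It.
apply: cvg_invmx; [exact: Wu| |exact: cW].
have : \forall s \near within I01 (nbhs t), I01 s by exact: withinT.
by apply: filterS => s; exact: Wu.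
Qed.

Lemma within_integrable (R : realType) (g : R -> R) :
  {within I01, continuous g} ->
  (@lebesgue_measure R).-integrable I01 (EFin \o g).
Proof.
by move=> cg; apply: continuous_compact_integrable => //; exact: segment_compact.
Qed.

Lemma Rintegral01D (R : realType) (g h : R -> R) :
  {within I01, continuous g} -> {within I01, continuous h} ->
  Rintegral lebesgue_measure I01 (fun t => g t + h t) =
  Rintegral lebesgue_measure I01 g + Rintegral lebesgue_measure I01 h.
Proof.
move=> /within_integrable gi /within_integrable hi.
by apply: RintegralD => //; exact: measurable_itv.
Qed.

Lemma le_Rintegral01 (R : realType) (g h : R -> R) :
  {within I01, continuous g} -> {within I01, continuous h} ->
  (forall t, I01 t -> g t <= h t) ->
  Rintegral lebesgue_measure I01 g <= Rintegral lebesgue_measure I01 h.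
Proof.
move=> /within_integrable gi /within_integrable hi gh.
by apply: le_Rintegral => //; exact: measurable_itv.
Qed.

(** * Derivatives relative to the unit interval *)

(** A relation between a curve and its velocity: it avoids the
    choice operator behind [derive_in], so that derivatives can be combined by
    limit rules alone. *)
Definition has_deriv01 (R : realType) (V : normedModType R) (g g' : R -> V) :=
  forall t, I01 t -> diff_quotient_in I01 g t --> g' t.

(** Every point of [0, 1], endpoints included, is the limit of other points of
    [0, 1], so that limits of difference quotients are unique and [derive_in]
    returns them. *)
Lemma quotient_filter_proper (R : realType) (t : R) : I01 t ->
  ProperFilter (within [set h : R | I01 (t + h)] (0 : R)^').
Proof.
rewrite /I01/= in_itv/= => /andP[t0 t1].
apply: Build_ProperFilter; rewrite /within/=.
move/nbhs_ballP=> [e /= e0 He].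
pose h := Num.min (e / 2) (1 / 2).
have h0 : 0 < h by rewrite /h lt_min; apply/andP; split; lra.
have he : h < e by rewrite /h gt_min; apply/orP; left; lra.
have h1 : h <= 1 / 2 by rewrite /h ge_min lexx orbT.
have [tl|tl] := leP t (1 / 2).
  apply: (He h); rewrite /ball/= ?sub0r ?normrN ?gtr0_norm ?gt_eqF//.
  by rewrite in_itv/=; apply/andP; split; lra.
apply: (He (- h)); rewrite /ball/= ?sub0r ?opprK ?gtr0_norm ?oppr_eq0 ?gt_eqF//.
by rewrite in_itv/=; apply/andP; split; lra.
Qed.

Lemma derive_inE (R : realType) (V : normedModType R) (g g' : R -> V) t :
  has_deriv01 g g' -> I01 t -> derive_in I01 g t = g' t.
Proof.
move=> gg' It; have FF := quotient_filter_proper It.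
exact: (@cvg_lim V (@norm_hausdorff R V) _ _ FF _ _ (gg' t It)).
Qed.

Lemma has_deriv01_derivable (R : realType) (V : normedModType R)
    (g g' : R -> V) t :
  has_deriv01 g g' -> I01 t -> derivable_in I01 g t.
Proof. by move=> gg' /gg' h; apply/cvg_ex; exists (g' t). Qed.

Lemma derivable_in_has_deriv01 (R : realType) (V : normedModType R)
    (g : R -> V) :
  (forall t, I01 t -> derivable_in I01 g t) ->
  has_deriv01 g (derive_in I01 g).
Proof. by move=> dg t /dg. Qed.

Lemma has_deriv01_entry (R : realType) p q (g g' : R -> 'M[R]_(p, q)) i j :
  has_deriv01 g g' ->
  has_deriv01 (fun t => g t i j : R^o) (fun t => g' t i j).
Proof.
move=> gg' t It; have FF := quotient_filter_proper It.
have := cvg_mx_entry FF (i:=i) (j:=j) (gg' t It); rewrite /diff_quotient_in.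
by under eq_fun do rewrite !mxE.
Qed.

Lemma has_deriv01_entries (R : realType) p q (g g' : R -> 'M[R]_(p, q)) :
  (forall i j, has_deriv01 (fun t => g t i j : R^o) (fun t => g' t i j)) ->
  has_deriv01 g g'.
Proof.
move=> gg' t It; have FF := quotient_filter_proper It.
apply: cvg_mx_entries => i j.
by under eq_fun do rewrite !mxE; exact: gg'.
Qed.

Lemma has_deriv01D (R : realType) (V : normedModType R) (f f' g g' : R -> V) :
  has_deriv01 f f' -> has_deriv01 g g' ->
  has_deriv01 (fun t => f t + g t) (fun t => f' t + g' t).
Proof.
move=> ff' gg' t It; have FF := quotient_filter_proper It.
rewrite /diff_quotient_in; under eq_fun do rewrite opprD addrACA scalerDr.
by apply: cvgD; [exact: ff'|exact: gg'].
Qed.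

Lemma has_deriv01B (R : realType) (V : normedModType R) (f f' g g' : R -> V) :
  has_deriv01 f f' -> has_deriv01 g g' ->
  has_deriv01 (fun t => f t - g t) (fun t => f' t - g' t).
Proof.
move=> ff' gg' t It; have FF := quotient_filter_proper It.
rewrite /diff_quotient_in.
under eq_fun do
  rewrite [- (f t - g t)]opprD opprK addrACA [- g _ + _]addrC
    -[g t - _]opprB scalerBr.
by apply: cvgB; [exact: ff'|exact: gg'].
Qed.

Lemma has_deriv01_cst (R : realType) (V : normedModType R) (a : V) :
  has_deriv01 (fun _ : R => a) (fun _ => 0).
Proof.
move=> t It; have FF := quotient_filter_proper It.
rewrite /diff_quotient_in; under eq_fun do rewrite subrr scaler0.
exact: cvg_cst.
Qed.

Lemma has_deriv01_mulmxl (R : realType) p q r (C : 'M[R]_(p, q))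
    (g g' : R -> 'M[R]_(q, r)) :
  has_deriv01 g g' -> has_deriv01 (fun t => C *m g t) (fun t => C *m g' t).
Proof.
move=> gg' t It; have FF := quotient_filter_proper It.
rewrite /diff_quotient_in; under eq_fun do rewrite -mulmxBr scalemxAr.
by apply: cvg_mulmx; [exact: cvg_cst|exact: gg'].
Qed.

Lemma has_deriv01_mulmxr (R : realType) p q r (C : 'M[R]_(q, r))
    (g g' : R -> 'M[R]_(p, q)) :
  has_deriv01 g g' -> has_deriv01 (fun t => g t *m C) (fun t => g' t *m C).
Proof.
move=> gg' t It; have FF := quotient_filter_proper It.
rewrite /diff_quotient_in; under eq_fun do rewrite -mulmxBl scalemxAl.
by apply: cvg_mulmx; [exact: gg'|exact: cvg_cst].
Qed.

Lemma has_deriv01_col_mx (R : realType) n m (x x' : R -> 'cV[R]_n)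
    (s s' : R -> 'cV[R]_m) :
  has_deriv01 x x' -> has_deriv01 s s' ->
  has_deriv01 (fun t => col_mx (x t) (s t)) (fun t => col_mx (x' t) (s' t)).
Proof.
move=> xx' ss'; apply: has_deriv01_entries => i j; case: (split_ordP i) => k ->.
  have := has_deriv01_entry (i := k) (j := j) xx'.
  by congr has_deriv01; apply/funext => t; rewrite col_mxEu.
have := has_deriv01_entry (i := k) (j := j) ss'.
by congr has_deriv01; apply/funext => t; rewrite col_mxEd.
Qed.

Lemma has_deriv01_usubmx (R : realType) n m (q q' : R -> 'cV[R]_(n + m)) :
  has_deriv01 q q' -> has_deriv01 (fun t => usubmx (q t)) (fun t => usubmx (q' t)).
Proof.
move=> qq'; apply: has_deriv01_entries => i j.
have := has_deriv01_entry (i := lshift m i) (j := j) qq'.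
by congr has_deriv01; apply/funext => t; rewrite mxE.
Qed.

Lemma has_deriv01_dsubmx (R : realType) n m (q q' : R -> 'cV[R]_(n + m)) :
  has_deriv01 q q' -> has_deriv01 (fun t => dsubmx (q t)) (fun t => dsubmx (q' t)).
Proof.
move=> qq'; apply: has_deriv01_entries => i j.
have := has_deriv01_entry (i := rshift n i) (j := j) qq'.
by congr has_deriv01; apply/funext => t; rewrite mxE.
Qed.

(** The limit of [g (t + h)] is written along the filter of the difference
    quotient, which is the form needed to compose with a difference quotient. *)
Lemma has_deriv01_shift (R : realType) (V : normedModType R) (g g' : R -> V) t :
  has_deriv01 g g' -> I01 t ->
  (fun h => g (t + h)) @ within [set h : R | I01 (t + h)] (0 : R)^' --> g t.
Proof.
move=> gg' It; have FF := quotient_filter_proper It.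
have h0 : (fun h : R => h) @ within [set h : R | I01 (t + h)] (0 : R)^' --> (0 : R).
  by move=> A A0; apply: cvg_within; apply: nbhs_dnbhs.
have : (fun h => g t + h *: (h^-1 *: (g (t + h) - g t))) @
    within [set h : R | I01 (t + h)] (0 : R)^' --> g t + 0 *: g' t.
  by apply: cvgD; [exact: cvg_cst|apply: cvgZ => //; exact: gg'].
rewrite scale0r addr0; apply: cvg_trans.
apply: near_eq_cvg; rewrite near_withinE; near=> h => _.
rewrite scalerA divff ?scale1r; first by rewrite addrC subrK.
by near: h; exact: nbhs_dnbhs_neq.
Unshelve. all: by end_near. Qed.

Lemma has_deriv01_continuous (R : realType) (V : normedModType R) (g g' : R -> V) :
  has_deriv01 g g' -> {within I01, continuous g}.
Proof.
move=> gg'; apply/subspace_continuousP => t It.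
apply/cvgrPdist_lt => e e0.
have := has_deriv01_shift gg' It; move/cvgrPdist_lt => /(_ e e0).
rewrite /within/= => /nbhs_ballP[d /= d0 hd].
apply/nbhs_ballP; exists d => //= s; rewrite /ball/= => ts Is.
have [->|st] := eqVneq s t; first by rewrite subrr normr0.
have := hd (s - t); rewrite /ball/= sub0r normrN distrC => /(_ ts).
by rewrite subr_eq0 addrC subrK; apply.
Qed.

Lemma has_deriv01_is_derive (R : realType) (g g' : R -> R) (t : R) :
  has_deriv01 (g : R -> R^o) g' -> t \in `]0, 1[ -> is_derive t 1 g (g' t).
Proof.
move=> gg'; rewrite in_itv/= => /andP[t0 t1].
have It : I01 t by rewrite /I01/= in_itv/= !ltW.
have h : (fun h : R => h^-1 *: ((g \o shift t) (h *: 1) - g t)) @ (0 : R)^' -->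
    g' t.
  have := gg' t It; rewrite /diff_quotient_in => q.
  apply: cvg_trans; last exact: q.
  move=> A /=; rewrite /within/= => hA.
  have hd : \forall h \near (0 : R)^', I01 (t + h).
    apply: nbhs_dnbhs; apply/nbhs_ballP; exists (Num.min t (1 - t)) => /=.
      by rewrite lt_min t0 subr_gt0.
    move=> h; rewrite /ball/= sub0r normrN lt_min !ltr_norml => /andP[/andP[? ?] /andP[? ?]].
    by rewrite /I01/= in_itv/=; apply/andP; split; lra.
  change (\forall h \near (0 : R)^', A (h^-1 *: ((g \o shift t) (h *: 1) - g t))).
  near=> h; have Ih : I01 (t + h) by near: h.
  have : A (h^-1 *: (g (t + h) - g t)) by move: Ih; near: h.
  by rewrite /= [h *: 1]mulr1 [t + h]addrC.
by split; [apply/cvg_ex; exists (g' t)|exact: cvg_lim h].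
Unshelve. all: by end_near. Qed.

(** The interior points carry ordinary derivatives and the endpoints only need
    continuity, so the usual mean value theorem applies. *)
Lemma has_deriv01_MVT (R : realType) (g g' : R -> R) :
  has_deriv01 (g : R -> R^o) g' -> exists2 c, I01 c & g 1 - g 0 = g' c.
Proof.
move=> gg'; have [||c c01 ->] := @MVT R g g' 0 1 ltr01.
- by move=> t; exact: has_deriv01_is_derive.
- exact: has_deriv01_continuous gg'.
exists c; last by rewrite subr0 mulr1.
by move: c01; rewrite /I01/= !in_itv/= => /andP[? ?]; apply/andP; split; exact: ltW.
Qed.

Lemma has_deriv01_FTC (R : realType) (g g' : R -> R) :
  has_deriv01 (g : R -> R^o) g' -> {within I01, continuous g'} ->
  Rintegral lebesgue_measure I01 g' = g 1 - g 0.
Proof.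
move=> gg' g'c; have gc := has_deriv01_continuous gg'.
rewrite /Rintegral (@continuous_FTC2 R g' g 0 1 ltr01)//; last first.
- move=> t t01; rewrite derive1E; exact: (@derive_val _ _ _ _ _ _ _ (has_deriv01_is_derive gg' t01)).
have /continuous_within_itvP [//|_ g0 g1] := gc.
split=> // t t01; exact: (@ex_derive _ _ _ _ _ _ _ (has_deriv01_is_derive gg' t01)).
Qed.

Lemma is_derive_has_deriv01 (R : realType) (g g' : R -> R) :
  (forall t, I01 t -> is_derive t (1 : R) g (g' t)) ->
  has_deriv01 (g : R -> R^o) g'.
Proof.
move=> gg' t /gg'[dg <-].
have : (fun h : R => h^-1 *: ((g \o shift t) (h *: 1) - g t)) @ (0 : R)^' -->
    'D_1 g t by exact: dg.
move=> {}dg; apply: cvg_trans dg => A /= hA.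
change (\forall h \near (0 : R)^', I01 (t + h) -> A (h^-1 *: (g (t + h) - g t))).
have {}hA : \forall h \near (0 : R)^',
  A (h^-1 *: ((g \o shift t) (h *: 1) - g t)) by exact: hA.
near=> h => _; rewrite [t + h]addrC.
have : A (h^-1 *: ((g \o shift t) (h *: 1) - g t)) by near: h.
by rewrite /= [h *: 1]mulr1.
Unshelve. all: by end_near. Qed.

(** * Primitives *)

Lemma continuous_has_primitive (R : realType) (g : R -> R) :
  continuous g ->
  exists G : R -> R, forall t, I01 t -> is_derive t (1 : R) G (g t).
Proof.
move=> cg; exists (fun x => Rintegral lebesgue_measure [set` `[-1, x]] g) => t.
rewrite /I01/= in_itv/= => /andP[t0 t1].
have [||||dG Gt] := @continuous_FTC1_closed R g (-1) t 2.
- by apply: le_lt_trans t1 _; rewrite ltrDl.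
- apply: continuous_compact_integrable; first exact: segment_compact.
  exact: continuous_subspaceT.
- by apply: lt_le_trans t0; rewrite ltrN10.
- exact: cg.
by apply: DeriveDef; [exact: dG|rewrite -derive1E; exact: Gt].
Qed.

(** Extending [g] by its endpoint values makes it continuous on the whole line,
    so that the primitive has two-sided derivatives even at 0 and 1. *)
Lemma within_has_primitive (R : realType) (g : R -> R) :
  {within I01, continuous g} ->
  exists G : R -> R, forall t, I01 t -> is_derive t (1 : R) G (g t).
Proof.
move=> /subspace_continuousP cg.
(* [cl] is the retraction of the line onto [0, 1]. *)
pose cl (t : R) := Num.max 0 (Num.min 1 t).
have I_cl t : I01 (cl t).
  by rewrite /I01/= in_itv/= /cl le_max lexx/= ge_max ler01 ge_min lexx.
have cl_id t : I01 t -> cl t = t.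
  rewrite /I01/= in_itv/= /cl => /andP[t0 t1].
  by rewrite (min_idPr t1) (max_idPr t0).
have [t|G hG] := @continuous_has_primitive R (g \o cl).
  apply: cvg_comp (cg (cl t) (I_cl t)).
  move=> A; rewrite /within/= => hA.
  have cc : {for t, continuous cl}.
    by apply: continuous_max; [exact: cvg_cst|apply: continuous_min => //; exact: cvg_cst].
  have {}hA : \forall s \near t, I01 (cl s) -> A (cl s) by exact: cc _ hA.
  have : \forall s \near t, A (cl s) by apply: filterS hA => s; apply; exact: I_cl.
  exact.
by exists G => t It; rewrite -{2}(cl_id t It); exact: hG.
Qed.

Lemma mx_within_has_primitive (R : realType) p q (V : R -> 'M[R]_(p, q)) :
  {within I01, continuous V} -> exists P, has_deriv01 P V.
Proof.
move=> /within_mx_entries cV.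
have /choice[G hG] : forall ij : 'I_p * 'I_q, exists G : R -> R,
    forall t, I01 t -> is_derive t (1 : R) G (V t ij.1 ij.2).
  by move=> [i j]; exact: within_has_primitive.
exists (fun t => \matrix_(i, j) G (i, j) t).
apply: has_deriv01_entries => i j.
have -> : (fun t => (\matrix_(i, j) G (i, j) t) i j) = G (i, j).
  by apply/funext => t; rewrite mxE.
apply: is_derive_has_deriv01; exact: hG (i, j).
Qed.

(** * Line integrals along segments *)

Section LineIntegral.
Variables (R : realType) (n : nat) (w : 'cV[R]_n -> 'rV[R]_n).
Implicit Types a b c d u v x y p : 'cV[R]_n.

Definition segment_primitive a b (G : R -> R) := forall t, I01 t ->
  is_derive t (1 : R) G ((w (a + t *: (b - a)) *m (b - a)) 0 0).

(** An affine change of parameter turns a primitive along a segment into a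
    primitive along any sub-segment, traversed in either direction. Reversal and
    bisection of line integrals both come from this, without a change of
    variables in an integral. *)
Lemma segment_primitive_sub a b G (s r : R) : segment_primitive a b G ->
  I01 s -> I01 r ->
  segment_primitive (a + s *: (b - a)) (a + r *: (b - a))
    (fun t => G (s + t * (r - s))).
Proof.
move=> hG Is Ir t It.
have J : I01 (s + t * (r - s)).
  move: Is Ir It; rewrite /I01/= !in_itv/= => /andP[s0 s1] /andP[r0 r1] /andP[t0 t1].
  have := mulr_ge0 t0 r0; have := mulr_ge0 t0 s0.
  have t1' : 0 <= 1 - t by lra. 
  have s1' : 0 <= 1 - s by lra. have r1' : 0 <= 1 - r by lra.
  have := mulr_ge0 t1' s0; have := mulr_ge0 t1' s1'; have := mulr_ge0 t0 r1'.
  by move=> *; apply/andP; split; nra.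
have E : a + r *: (b - a) - (a + s *: (b - a)) = (r - s) *: (b - a).
  by rewrite scalerBl opprD addrACA subrr add0r.
rewrite E; have D : is_derive t (1 : R) (fun t => s + t * (r - s)) (r - s).
  by apply: is_derive_eq; rewrite add0r mul1r scaler0 add0r [_%:A]mulr1.
have H := @is_derive1_comp R G (fun t => s + t * (r - s)) t _ _ (hG _ J) D; rewrite /comp in H.
apply: is_derive_eq H _.
by rewrite scalerA -addrA -scalerDl -scalemxAr [in RHS]mxE mulrC.
Qed.

Definition line_integral a b : R := Rintegral lebesgue_measure I01
  (fun t => (w (a + t *: (b - a)) *m (b - a)) 0 0).

Hypothesis w_cont : continuous w.

Lemma segment_integrand_continuous a b :
  continuous (fun t : R => (w (a + t *: (b - a)) *m (b - a)) 0 0).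
Proof.
move=> t; apply: (@cvg_mx_entry R R (nbhs t) _ 1 1).
apply: cvg_mulmx; last exact: cvg_cst.
apply: (cvg_comp (fun s => a + s *: (b - a)) w); last exact: w_cont.
by apply: cvgD; [exact: cvg_cst|apply: cvgZ; [exact: cvg_id|exact: cvg_cst]].
Qed.

Lemma line_integralE a b G : segment_primitive a b G ->
  line_integral a b = G 1 - G 0.
Proof.
move=> hG; rewrite /line_integral; apply: has_deriv01_FTC.
  exact: is_derive_has_deriv01.
apply: continuous_subspaceT; exact: segment_integrand_continuous.
Qed.

Lemma line_integral_sub a b : exists G, segment_primitive a b G /\
  forall s r, I01 s -> I01 r ->
  line_integral (a + s *: (b - a)) (a + r *: (b - a)) = G r - G s.
Proof.
have [G hG] := continuous_has_primitive (@segment_integrand_continuous a b).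
exists G; split=> // s r Is Ir.
rewrite (line_integralE (segment_primitive_sub hG Is Ir)).
by rewrite mul1r mul0r addr0 addrCA subrr addr0.
Qed.

Lemma line_integralN a b : line_integral b a = - line_integral a b.
Proof.
have [G [_ hG]] := line_integral_sub a b.
have I0 : I01 (0 : R) by rewrite /I01/= in_itv/= lexx ler01.
have I1 : I01 (1 : R) by rewrite /I01/= in_itv/= lexx ler01.
have := hG _ _ I0 I1; have := hG _ _ I1 I0.
by rewrite !scale0r !scale1r !addr0 addrC subrK => -> ->; rewrite opprB.
Qed.

Lemma line_integral_midpoint a b (m : 'cV[R]_n) : m = 2^-1 *: (a + b) ->
  line_integral a b = line_integral a m + line_integral m b.
Proof.
move=> mE; have [G [_ hG]] := line_integral_sub a b.
have I0 : I01 (0 : R) by rewrite /I01/= in_itv/= lexx ler01.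
have I1 : I01 (1 : R) by rewrite /I01/= in_itv/= lexx ler01.
have I2 : I01 (2^-1 : R) by rewrite /I01/= in_itv/=; apply/andP; split; lra.
have -> : m = a + 2^-1 *: (b - a).
  by rewrite mE; apply/matrixP => i j; rewrite !mxE; lra.
have := hG _ _ I0 I1; have := hG _ _ I0 I2; have := hG _ _ I2 I1.
rewrite !scale0r !scale1r !addr0 [a + (b - a)]addrC subrK => -> -> ->.
lra.
Qed.

(** On short segments this plays the part of a formula for the gradient of the
    potential. *)
Lemma line_integral_MVT a b : exists2 c, I01 c &
  line_integral a b = (w (a + c *: (b - a)) *m (b - a)) 0 0.
Proof.
have [G hG] := continuous_has_primitive (@segment_integrand_continuous a b).
rewrite (line_integralE hG).
exact: has_deriv01_MVT (is_derive_has_deriv01 hG).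
Qed.

Definition triangle_integral a b c : R :=
  line_integral a b + line_integral b c + line_integral c a.

(** All triangles produced by repeated medial subdivision are homothetic to the
    first one, so a corner and a signed ratio are enough to describe them; the
    medial triangle has a negative ratio. *)
Definition corner_triangle u v p (s : R) : R :=
  triangle_integral p (p + s *: u) (p + s *: v).

(** The inner sides are each traversed once in both directions and cancel. *)
Lemma corner_triangle_subdivide u v p s :
  corner_triangle u v p s =
    corner_triangle u v p (s / 2) + corner_triangle u v (p + (s / 2) *: u) (s / 2)
    + corner_triangle u v (p + (s / 2) *: v) (s / 2)
    + corner_triangle u v (p + (s / 2) *: (u + v)) (- (s / 2)).
Proof.
rewrite /corner_triangle/=.
set a := p; set b := p + s *: u; set c := p + s *: v.
set mab := p + _ *: u; set mac := p + _ *: v; set mbc := p + _ *: (u + v).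
have -> : mab + s / 2 *: u = b by apply/matrixP => i j; rewrite !mxE; lra.
have -> : mac + s / 2 *: v = c by apply/matrixP => i j; rewrite !mxE; lra.
have -> : mab + s / 2 *: v = mbc by apply/matrixP => i j; rewrite !mxE; lra.
have -> : mac + s / 2 *: u = mbc by apply/matrixP => i j; rewrite !mxE; lra.
have -> : mbc + - (s / 2) *: u = mac by apply/matrixP => i j; rewrite !mxE; lra.
have -> : mbc + - (s / 2) *: v = mab by apply/matrixP => i j; rewrite !mxE; lra.
rewrite /triangle_integral.
rewrite (@line_integral_midpoint a b mab); last by apply/matrixP => i j; rewrite !mxE; lra.
rewrite (@line_integral_midpoint b c mbc); last by apply/matrixP => i j; rewrite !mxE; lra.
rewrite (@line_integral_midpoint c a mac); last by apply/matrixP => i j; rewrite !mxE; lra.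
rewrite (line_integralN mab mac) (line_integralN mab mbc) (line_integralN mac mbc).
move: (line_integral a mab) (line_integral mab b) (line_integral b mbc)
  (line_integral mbc c) (line_integral c mac) (line_integral mac a)
  (line_integral mab mac) (line_integral mab mbc) (line_integral mac mbc).
by move=> *; lra.
Qed.

(** One step of Goursat's argument: one of the four pieces carries at least a
    quarter of the integral. Its corner may be any of the four, which gives the
    bound on the displacement. *)
Lemma corner_triangle_descend u v p s : exists q : 'cV[R]_n * R,
  [/\ `|q.2| = `|s| / 2, `|q.1 - p| <= `|s| * (`|u| + `|v|) &
      `|corner_triangle u v p s| <= 4 * `|corner_triangle u v q.1 q.2|].
Proof.
have s2 : `|s / 2| = `|s| / 2 by rewrite normrM [`|2^-1|]ger0_norm.
have s2x (x : 'cV[R]_n) : `|x| <= `|u| + `|v| ->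
    `|p + (s / 2) *: x - p| <= `|s| * (`|u| + `|v|).
  move=> xuv; rewrite addrAC subrr add0r normrZ s2; apply: ler_pM => //.
  by rewrite ler_pdivrMr// ler_peMr// ler1n.
have pigeonhole (t1 t2 t3 t4 : R) : let t := t1 + t2 + t3 + t4 in
    [\/ `|t| <= 4 * `|t1|, `|t| <= 4 * `|t2|, `|t| <= 4 * `|t3|
      | `|t| <= 4 * `|t4|].
  move=> t; have [h1|h1] := leP `|t| (4 * `|t1|); first exact: Or41.
  have [h2|h2] := leP `|t| (4 * `|t2|); first exact: Or42.
  have [h3|h3] := leP `|t| (4 * `|t3|); first exact: Or43.
  apply: Or44; have := ler_normD (t1 + t2 + t3) t4.
  have := ler_normD (t1 + t2) t3; have := ler_normD t1 t2; rewrite -/t.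
  move: h1 h2 h3; lra.
rewrite corner_triangle_subdivide.
have [] := pigeonhole (corner_triangle u v p (s / 2))
  (corner_triangle u v (p + (s / 2) *: u) (s / 2))
  (corner_triangle u v (p + (s / 2) *: v) (s / 2))
  (corner_triangle u v (p + (s / 2) *: (u + v)) (- (s / 2))).
- exists (p, s / 2); split; [exact: s2| |by []].
  by rewrite subrr normr0 mulr_ge0// addr_ge0.
- exists (p + (s / 2) *: u, s / 2); split; [exact: s2| |by []].
  by apply: s2x; rewrite lerDl.
- exists (p + (s / 2) *: v, s / 2); split; [exact: s2| |by []].
  by apply: s2x; rewrite lerDr.
exists (p + (s / 2) *: (u + v), - (s / 2)); split; [by rewrite normrN| |by []].
by apply: s2x; exact: ler_normD.
Qed.

End LineIntegral.

(** * Closed differentiable forms are exact *)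

(** The distance to the limit is a tail of the geometric series with ratio one
    half, hence the factor 2. *)
Lemma geometric_steps_cvg (R : realType) n (p_ : nat -> 'cV[R]_n) (M : R) :
  (forall k, `|p_ k.+1 - p_ k| <= M / 2 ^+ k) ->
  exists l, forall k, `|p_ k - l| <= 2 * M / 2 ^+ k.
Proof.
move=> hp.
have M0 : 0 <= M.
  by have := le_trans (normr_ge0 _) (hp 0%N); rewrite expr0 divr1.
have pow0 k : 0 < (2 : R) ^+ k by rewrite exprn_gt0.
(* The exact tail bound is the one that an induction on [i] can carry. *)
have step k i : `|p_ (k + i)%N - p_ k| <= 2 * M / 2 ^+ k - 2 * M / 2 ^+ (k + i)%N.
  elim: i => [|i IH].
    by rewrite addn0 !subrr normr0.
  rewrite addnS; have -> : p_ (k + i)%N.+1 - p_ k =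
    (p_ (k + i)%N.+1 - p_ (k + i)%N) + (p_ (k + i)%N - p_ k) by rewrite addrA subrK.
  apply: le_trans (ler_normD _ _) _.
  have := hp (k + i)%N; rewrite exprS.
  have -> : 2 * M / (2 * 2 ^+ (k + i)%N) = M / 2 ^+ (k + i)%N :> R.
    by field; rewrite gt_eqF.
  lra.
have step' k i : `|p_ (k + i)%N - p_ k| <= 2 * M / 2 ^+ k.
  apply: le_trans (step k i) _; by rewrite gerBl divr_ge0 ?mulr_ge0// ltW.
have small (e : R) : 0 < e -> \forall k \near \oo, 2 * M / 2 ^+ k < e.
  move=> e0; have : (fun k => 2 * M * (2^-1 : R) ^+ k) @ \oo --> 2 * M * 0.
    apply: cvgM; first exact: cvg_cst.
    by apply: cvg_expr; rewrite ger0_norm ?invr_ge0// invf_lt1// ltr1n.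
  rewrite mulr0 => /cvgrPdist_lt /(_ e e0); apply: filterS => k.
  by rewrite sub0r normrN exprVn; apply: le_lt_trans; exact: ler_norm.
have : cvgn p_.
  apply/cauchy_cvgP; apply/cauchy_ballP => e e0.
  have [N _ hN] := small (e / 2) ltac:(by rewrite divr_gt0).
  exists (p_ @` [set k | (N <= k)%N], p_ @` [set k | (N <= k)%N]).
    by split; exists N => // k /= Nk; exists k.
  move=> [x y] /= [[i /= Ni <-] [j /= Nj <-]].
  rewrite -ball_normE /=.
  have hN' : 2 * M / 2 ^+ N < e / 2 by apply: hN => /=.
  have := step' N (i - N)%N; have := step' N (j - N)%N; rewrite !subnKC// => hj hi.
  have -> : p_ i - p_ j = (p_ i - p_ N) - (p_ j - p_ N) by rewrite opprB addrA subrK.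
  apply: le_lt_trans (ler_normB _ _) _; lra.
move=> /cvg_ex[l pl]; exists l => k.
rewrite distrC; apply/ler_addgt0Pr => e e0.
move/cvgrPdist_lt: pl => /(_ e e0)[N _ hN].
have := hN (k + N)%N (leq_addl _ _) => /= h1; have h2 := step' k N.
have -> : l - p_ k = (l - p_ (k + N)%N) + (p_ (k + N)%N - p_ k) by rewrite addrA subrK.
apply: le_trans (ler_normD _ _) _; lra.
Qed.

Section Goursat.
Variables (R : realType) (n : nat) (w : 'cV[R]_n -> 'rV[R]_n).
Hypothesis w_cont : continuous w.
Implicit Types a b c u v p : 'cV[R]_n.

(** Near [p] the form is its affine approximation up to [e], and an affine form
    with symmetric linear part [B] is the differential of the quadratic function
    [phi]. Subtracting [phi] along the segment leaves a function whose derivative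
    is the approximation error. *)
Lemma line_integral_affine_approx (p a b : 'cV[R]_n) (B : 'M[R]_n) (e r : R) :
  let phi y := (w p *m (y - p)) 0 0 + 2^-1 * ((y - p)^T *m B *m (y - p)) 0 0 in
  B^T = B -> `|a - p| <= r -> `|b - p| <= r ->
  (forall y, `|y - p| <= r -> `|w y - w p - (y - p)^T *m B| <= e) ->
  `|line_integral w a b - (phi b - phi a)| <= n%:R * (e * `|b - a|).
Proof.
move=> phi BT ap bp approx.
pose q u v := (u^T *m B *m v) 0 0.
have qC u v : q u v = q v u.
  by rewrite /q -[u^T *m B *m v]trmxK mxE !trmx_mul trmxK BT mulmxA.
have qD x y z : q x (y + z) = q x y + q x z by rewrite /q mulmxDr mxE.
have qDD x y : q (x + y) (x + y) = q x x + 2 * q x y + q y y.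
  rewrite qD [q (x + y) x]qC [q (x + y) y]qC !qD [q y x]qC; ring.
pose d := b - a.
pose al := (w p *m d) 0 0 + q (a - p) d.
have [G hG] := continuous_has_primitive (segment_integrand_continuous w_cont (a:=a) (b:=b)).
have phiab : phi b - phi a = al + 2^-1 * q d d.
  rewrite /phi /al.
  have -> : b - p = (a - p) + d by rewrite /d [RHS]addrC subrKA.
  rewrite -/(q _ _) -/(q _ _) mulmxDr mxE.
  by rewrite qDD; lra.
rewrite (line_integralE w_cont hG) phiab.
pose H t := G t - (t * al + t ^+ 2 * (2^-1 * q d d)).
have -> : G 1 - G 0 - (al + 2^-1 * q d d) = H 1 - H 0.
  rewrite /H expr1n expr0n/=; lra.
have dH t : I01 t -> is_derive t (1 : R) H
    (((w (a + t *: d) - w p - (a + t *: d - p)^T *m B) *m d) 0 0).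
  move=> It; have hGt := hG t It; rewrite /H.
  apply: is_derive_eq.
  have subE (X Y : 'M[R]_1) : (X - Y) 0 0 = X 0 0 - Y 0 0 by rewrite !mxE.
  have qZ x y (z : R) : q x (z *: y) = z * q x y by rewrite /q -scalemxAr mxE.
  rewrite !mulmxBl !subE -/(q _ d) -/d.
  have -> : a + t *: d - p = (a - p) + t *: d by rewrite addrAC.
  rewrite [q (_ + _) d]qC qD qZ [q d (a - p)]qC /al.
  move: (q (a - p) d) (q d d) ((w p *m d) 0 0) => x y z.
  by rewrite /GRing.scale/=; field.
have [c Ic ->] := has_deriv01_MVT (is_derive_has_deriv01 dH).
apply: le_trans (norm_pairing_le _ _) _.
rewrite ler_wpM2l// ler_wpM2r//.
apply: approx.
have -> : a + c *: d - p = (1 - c) *: (a - p) + c *: (b - p).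
  by apply/matrixP => i j; rewrite /d !mxE; ring.
move: Ic; rewrite /I01/= in_itv/= => /andP[c0 c1].
apply: le_trans (ler_normD _ _) _; rewrite !normrZ.
rewrite (ger0_norm c0) ger0_norm ?subr_ge0//.
have := ler_wpM2l c0 bp; have c1' : 0 <= 1 - c by rewrite subr_ge0.
have := ler_wpM2l c1' ap; lra.
Qed.

Hypothesis w_jacobian : forall p, exists2 B : 'M[R]_n, B^T = B &
  forall e, 0 < e -> \forall y \near p,
    `|w y - w p - (y - p)^T *m B| <= e * `|y - p|.

(** The differences of [phi] cancel around a triangle, so only the
    approximation error [e * r] times a perimeter of at most [6 * r] survives,
    up to the factor [n%:R] of [norm_pairing_le]. *)
Lemma small_triangle_integral p (e : R) : 0 < e ->
  exists2 d, 0 < d & forall r a b c, r < d ->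
    `|a - p| <= r -> `|b - p| <= r -> `|c - p| <= r ->
    `|triangle_integral w a b c| <= 6 * n%:R * e * r ^+ 2.
Proof.
move=> e0; have [B BT hB] := w_jacobian p.
have /nbhs_ballP[d /= d0 hd] := hB e e0; exists d => // r a b c rd ap bp cp.
have r0 : 0 <= r := le_trans (normr_ge0 _) ap.
have side x y : `|x - p| <= r -> `|y - p| <= r -> `|line_integral w x y -
    ((w p *m (y - p)) 0 0 + 2^-1 * ((y - p)^T *m B *m (y - p)) 0 0 -
     ((w p *m (x - p)) 0 0 + 2^-1 * ((x - p)^T *m B *m (x - p)) 0 0))|
    <= n%:R * (e * r * (2 * r)).
  move=> xp yp.
  have approx z : `|z - p| <= r -> `|w z - w p - (z - p)^T *m B| <= e * r.
    move=> zp; have := hd z; rewrite -ball_normE /= distrC => /(_ (le_lt_trans zp rd)) h.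
    by apply: le_trans h _; rewrite ler_wpM2l// ltW.
  apply: le_trans (line_integral_affine_approx BT xp yp approx) _.
  rewrite ler_wpM2l// ler_wpM2l//; first by rewrite mulr_ge0// ltW.
  have -> : y - x = (y - p) - (x - p) by rewrite opprB addrA subrK.
  by apply: le_trans (ler_normB _ _) _; rewrite mulr_natl mulr2n lerD.
have := side _ _ ap bp; have := side _ _ bp cp; have := side _ _ cp ap.
rewrite /triangle_integral.
set fa := (_ + _ * ((a - p)^T *m _ *m _) 0 0).
set fb := (_ + _ * ((b - p)^T *m _ *m _) 0 0).
set fc := (_ + _ * ((c - p)^T *m _ *m _) 0 0).
move: (line_integral w a b) (line_integral w b c) (line_integral w c a) fa fb fc.
move=> x y z fa fb fc hz hy hx.
have -> : x + y + z = (x - (fb - fa)) + (y - (fc - fb)) + (z - (fa - fc)) by ring.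
have -> : 6 * n%:R * e * r ^+ 2 = n%:R * (e * r * (2 * r)) + n%:R * (e * r * (2 * r))
  + n%:R * (e * r * (2 * r)) by ring.
apply: le_trans (ler_normD _ _) _; rewrite lerD//.
by apply: le_trans (ler_normD _ _) _; rewrite lerD.
Qed.

(** Goursat's argument. A nonzero integral would give nested triangles
    whose integrals decrease at most like [4 ^- k]; they shrink to a point, near
    which the integral is negligible compared with [4 ^- k]. The derivative of
    [w] is used only at that limit point, whereas differentiating under the
    integral sign would require it to be continuous. *)
Lemma corner_triangle_eq0 u v p : corner_triangle w u v p 1 = 0.
Proof.
pose M := `|u| + `|v|.
have M0 : 0 <= M by rewrite addr_ge0.
have /choice[next hnext] : forall z : 'cV[R]_n * R, exists q : 'cV[R]_n * R,
  [/\ `|q.2| = `|z.2| / 2, `|q.1 - z.1| <= `|z.2| * (`|u| + `|v|) &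
   `|corner_triangle w u v z.1 z.2| <= 4 * `|corner_triangle w u v q.1 q.2|].
  by move=> z; exact: corner_triangle_descend.
pose z k := iter k next (p, 1).
have z2 k : `|(z k).2| = (2 ^+ k)^-1.
  elim: k => [|k IH]; first by rewrite /z/= normr1 expr0 invr1.
  have [-> _ _] := hnext (z k); rewrite IH exprS invfM mulrC; ring.
have z1 k : `|(z k.+1).1 - (z k).1| <= M / 2 ^+ k.
  by have [_ + _] := hnext (z k); rewrite z2 mulrC.
have zT k : `|corner_triangle w u v p 1| <=
    4 ^+ k * `|corner_triangle w u v (z k).1 (z k).2|.
  elim: k => [|k IH]; first by rewrite expr0 mul1r.
  apply: le_trans IH _; rewrite exprSr -mulrA ler_wpM2l ?exprn_ge0//.
  by have [] := hnext (z k).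
have [l hl] := geometric_steps_cvg z1.
apply/eqP; rewrite -normr_le0; apply/ler_addgt0Pr => e e0; rewrite add0r.
(* The vertices of the k-th triangle are within [(3 * M + 1) / 2 ^+ k] of the
   limit [l]; the last summand of [C] only makes it positive, to divide by it. *)
pose C := 6 * n%:R * (3 * M + 1) ^+ 2 + 1.
have C0 : 0 < C by rewrite ltr_wpDl// mulr_ge0 ?sqr_ge0// mulr_ge0.
have [d d0 hd] := small_triangle_integral l (divr_gt0 e0 C0).
have [k hk] : exists k, (3 * M + 1) / 2 ^+ k < d.
  have : (fun k => (3 * M + 1) * (2^-1 : R) ^+ k) @ \oo --> (3 * M + 1) * 0.
    apply: cvgM; first exact: cvg_cst.
    by apply: cvg_expr; rewrite ger0_norm ?invr_ge0// invf_lt1// ltr1n.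
  rewrite mulr0 => /cvgrPdist_lt /(_ d d0)[N _ hN]; exists N.
  have := hN N (leqnn _); rewrite /= sub0r normrN exprVn.
  by apply: le_lt_trans; exact: ler_norm.
have pk : 0 < (2 : R) ^+ k by rewrite exprn_gt0.
have near_l x : `|x| <= M -> `|(z k).1 + (z k).2 *: x - l| <= (3 * M + 1) / 2 ^+ k.
  move=> xM; have -> : (z k).1 + (z k).2 *: x - l = ((z k).1 - l) + (z k).2 *: x.
    by rewrite addrAC.
  apply: le_trans (ler_normD _ _) _; rewrite normrZ z2.
  have := hl k; have : (2 ^+ k)^-1 * `|x| <= (2 ^+ k)^-1 * M.
    by rewrite ler_wpM2l// invr_ge0 ltW.
  have : 0 <= (2 ^+ k)^-1 :> R by rewrite invr_ge0 ltW.
  by move: ((2 ^+ k)^-1) `|x| `|(z k).1 - l| => i y t; lra.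
have near0 : `|(z k).1 - l| <= (3 * M + 1) / 2 ^+ k.
  by have := near_l 0; rewrite scaler0 addr0 normr0; apply.
have hu : `|u| <= M by rewrite lerDl.
have hv : `|v| <= M by rewrite lerDr.
apply: le_trans (zT k) _.
have := hd _ _ _ _ hk near0 (near_l u hu) (near_l v hv).
rewrite -/(corner_triangle w u v (z k).1 (z k).2).
move: (`|corner_triangle _ _ _ _ _|) => T hT.
have p4 : 4 ^+ k = 2 ^+ k * 2 ^+ k :> R by rewrite -exprMn -natrM.
apply: (@le_trans _ _ (4 ^+ k * (6 * n%:R * (e / C) * ((3 * M + 1) / 2 ^+ k) ^+ 2))).
  by rewrite ler_wpM2l// exprn_ge0.
have -> : 4 ^+ k * (6 * n%:R * (e / C) * ((3 * M + 1) / 2 ^+ k) ^+ 2) =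
    (C - 1) * (e / C).
  rewrite p4 /C; field; rewrite gt_eqF//=; exact: lt0r_neq0.
rewrite mulrBl mul1r [C * _]mulrC divfK ?gt_eqF// gerBl.
by rewrite divr_ge0// ltW.
Qed.

(** The potential is the integral along the segment from the origin.
    Its increment is the integral along [x, y] because the triangle with vertices
    0, [x], [y] contributes nothing; the mean value theorem along [x, y] then gives
    a form of differentiability that composes directly with curves. *)
Lemma closed_form_has_potential : exists S : 'cV[R]_n -> R, forall x y,
  exists2 c, I01 c & S y - S x = (w (x + c *: (y - x)) *m (y - x)) 0 0.
Proof.
exists (line_integral w 0) => x y.
have [c Ic cE] := line_integral_MVT w_cont x y; exists c => //.
rewrite -cE; have := corner_triangle_eq0 x y 0.
rewrite /corner_triangle /triangle_integral !scale1r !add0r.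
rewrite (line_integralN w_cont 0 y); lra.
Qed.

End Goursat.

(** The difference quotient of [S] along the curve equals the form at an
    intermediate point applied to the difference quotient of the curve; that
    point tends to [x t]. This is the chain rule without a separate study of the
    differentiability of [S]. *)
Lemma has_deriv01_potential (R : realType) n (w : 'cV[R]_n -> 'rV[R]_n)
    (S : 'cV[R]_n -> R) (x x' : R -> 'cV[R]_n) :
  continuous w ->
  (forall x y, exists2 c, I01 c &
     S y - S x = (w (x + c *: (y - x)) *m (y - x)) 0 0) ->
  has_deriv01 x x' ->
  has_deriv01 (fun t => S (x t) : R^o) (fun t => (w (x t) *m x' t) 0 0).
Proof.
move=> cw mvS xx' t It; have FF := quotient_filter_proper It.
have /choice[c hc] : forall y, exists c, I01 c /\
    S y - S (x t) = (w (x t + c *: (y - x t)) *m (y - x t)) 0 0.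
  by move=> y; have [c Ic cE] := mvS (x t) y; exists c.
have xc : (fun h => x t + c (x (t + h)) *: (x (t + h) - x t)) @
    within [set h : R | I01 (t + h)] (0 : R)^' --> x t.
  apply/cvgrPdist_lt => e e0.
  have /cvgrPdist_lt /(_ e e0) := has_deriv01_shift xx' It.
  apply: filterS => h; apply: le_lt_trans.
  have [+ _] := hc (x (t + h)); rewrite /I01/= in_itv/= => /andP[c0 c1].
  by rewrite opprD addrA subrr add0r normrN normrZ ger0_norm// distrC ler_piMl.
rewrite /diff_quotient_in.
have -> : (fun h => h^-1 *: (S (x (t + h)) - S (x t) : R^o)) =
    (fun h => (w (x t + c (x (t + h)) *: (x (t + h) - x t)) *m
               (h^-1 *: (x (t + h) - x t))) 0 0).
  by apply/funext => h; have [_ ->] := hc (x (t + h)); rewrite -scalemxAr [RHS]mxE.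
apply: cvg_mx_entry; apply: cvg_mulmx; last exact: xx'.
exact: cvg_comp xc (cw _).
Qed.

Lemma derive_mx_entry (R : realType) (V : normedModType R) p q
    (A : V -> 'M[R]_(p, q)) (x v : V) i j :
  derivable A x v -> 'D_v (fun y => A y i j) x = ('D_v A x) i j.
Proof.
move=> dA; apply: cvg_lim => //.
have : (fun h : R => (h^-1 *: ((A \o shift x) (h *: v) - A x)) i j) @ 0^' -->
    ('D_v A x) i j by apply: cvg_mx_entry; exact: dA.
by under eq_fun do rewrite !mxE.
Qed.

(** The Jacobian matrix of a row of [A] is symmetric precisely when that row is
    a closed form. *)
Lemma row_jacobian (R : realType) n m (A : 'cV[R]_n -> 'M[R]_(m, n))
    (j : 'I_m) (p : 'cV[R]_n) :
  differentiable A p ->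
  (forall i k : 'I_n, 'D_(delta_mx k 0) (fun y => A y j i) p =
                      'D_(delta_mx i 0) (fun y => A y j k) p) ->
  exists2 B : 'M[R]_n, B^T = B &
  forall e, 0 < e -> \forall y \near p,
    `|row j (A y) - row j (A p) - (y - p)^T *m B| <= e * `|y - p|.
Proof.
move=> dA sym; have dAv v := diff_derivable (v := v) dA.
exists (\matrix_(k, i) ('d A p (delta_mx k 0)) j i).
  apply/matrixP => k i; rewrite !mxE -!deriveE// -!derive_mx_entry//.
move=> e e0.
have [_ /eqaddoP /(_ e e0)] := (diff_locallyP p A).1 dA.
move=> h; have {h} : \forall h \near p - p,
    `|A (h + p) - (A p + 'd A p h)| <= e * `|h| by rewrite subrr.
have pc : (fun y => y - p) @ nbhs p --> p - p.
  by apply: (@cvgB _ _ _ _ (nbhs_filter p)); [exact: cvg_id|exact: cvg_cst].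
move=> {}/pc h; have {h} : \forall y \near p,
    `|A (y - p + p) - (A p + 'd A p (y - p))| <= e * `|y - p| by exact: h.
apply: filterS => y; rewrite subrK.
apply: le_trans; apply: mx_norm_le => // o i.
apply: le_trans (mx_entry_le_norm _ j i); rewrite !mxE opprD addrA.
suff -> : \sum_k (y - p)^T o k * (\matrix_(k, i) ('d A p (delta_mx k 0)) j i) k i =
  'd A p (y - p) j i by [].
have yE : y - p = \sum_k (y - p) k 0 *: delta_mx k 0.
  by rewrite {1}(matrix_sum_delta (y - p)); apply: eq_bigr => k _; rewrite big_ord1.
rewrite {2}yE linear_sum summxE; apply: eq_bigr => k _.
by rewrite linearZ [RHS]mxE !mxE ord1.
Qed.

(** The rows of [A] are closed forms, so [A] is the Jacobian matrix of a map [S];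
    only its action on curves matters, since [A (x t) *m x' t] is then an exact time
    derivative. *)
Lemma closed_matrix_has_potential (R : realType) n m
    (A : 'cV[R]_n -> 'M[R]_(m, n)) :
  (forall x, differentiable A x) ->
  (forall (x : 'cV[R]_n) (j : 'I_m) (i k : 'I_n),
     'D_(delta_mx k 0) (fun y => A y j i) x =
     'D_(delta_mx i 0) (fun y => A y j k) x) ->
  exists S : 'cV[R]_n -> 'cV[R]_m, forall x x' : R -> 'cV[R]_n,
    has_deriv01 x x' ->
    has_deriv01 (fun t => S (x t)) (fun t => A (x t) *m x' t).
Proof.
move=> dA symA.
have cA : continuous A by move=> x; exact: differentiable_continuous.
have /choice[S hS] : forall j, exists S : 'cV[R]_n -> R, forall x y,
    exists2 c, I01 c &
      S y - S x = (row j (A (x + c *: (y - x))) *m (y - x)) 0 0.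
  move=> j; apply: (closed_form_has_potential (row_continuous (j := j) cA)) => p.
  by apply: row_jacobian => // i k; exact: symA.
exists (fun x => \col_j S j x) => x x' xx'.
apply: has_deriv01_entries => j k; rewrite ord1.
have := has_deriv01_potential (row_continuous (j := j) cA) (hS j) xx'.
congr has_deriv01; apply/funext => t; first by rewrite mxE.
by rewrite -row_mul mxE.
Qed.

(** * Symmetric positive definite matrices *)

Section SymmetricPositiveDefinite.
Variables (R : realType) (m : nat) (M : 'M[R]_m).
Hypothesis M_spd : spd_mx M.

Lemma spd_unitmx : M \in unitmx.
Proof.
have [_ pos] := M_spd.
rewrite unitmxE unitfE; apply/det0P => -[v v0 vM].
have /pos : v^T != 0 by apply: contra v0 => /eqP h; rewrite -[v]trmxK h trmx0.
by rewrite trmxK vM mul0mx mxE ltxx.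
Qed.

Lemma trmx_inv_spd : (invmx M)^T = invmx M.
Proof. by have [MT _] := M_spd; rewrite trmx_inv MT. Qed.

(** Substitute [invmx M *m s] in the positivity of [M]. *)
Lemma inv_spd_gt0 (s : 'cV[R]_m) : s != 0 -> 0 < (s^T *m invmx M *m s) 0 0.
Proof.
move=> s0; have Mu := spd_unitmx.
have v0 : invmx M *m s != 0.
  by apply: contra s0 => /eqP h; rewrite -[s](mulKVmx Mu) h mulmx0.
have [_ /(_ _ v0)] := M_spd.
by rewrite trmx_mul trmx_inv_spd -!mulmxA mulKVmx.
Qed.

Lemma spd_ge0 (s : 'cV[R]_m) : 0 <= (s^T *m M *m s) 0 0.
Proof.
have [->|s0] := eqVneq s 0; first by rewrite mulmx0 mxE.
by apply: ltW; have [_] := M_spd; apply.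
Qed.

Lemma sqr_wnorm (s : 'cV[R]_m) : wnorm M s ^+ 2 = (s^T *m M *m s) 0 0.
Proof. by rewrite /wnorm sqr_sqrtr// spd_ge0. Qed.

Lemma sqr_wnorm_momentum (c : 'cV[R]_m) :
  wnorm M (invmx M *m c) ^+ 2 = (c^T *m invmx M *m c) 0 0.
Proof.
by rewrite sqr_wnorm trmx_mul trmx_inv_spd -!mulmxA mulKVmx// spd_unitmx.
Qed.

(** Convexity of the squared norm: its graph lies above its tangent at
    [invmx M *m c], where the gradient of half the squared norm is [c]. *)
Lemma sqr_wnorm_tangent (c s : 'cV[R]_m) :
  wnorm M (invmx M *m c) ^+ 2 + 2 * (c^T *m (s - invmx M *m c)) 0 0 <=
  wnorm M s ^+ 2.
Proof.
rewrite sqr_wnorm_momentum sqr_wnorm.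
have [z ->] : exists z, s = z + invmx M *m c.
  by exists (s - invmx M *m c); rewrite subrK.
rewrite addrK.
have [MT _] := M_spd; have Mu := spd_unitmx.
have addE (X Y : 'M[R]_1) : (X + Y) 0 0 = X 0 0 + Y 0 0 by rewrite mxE.
have tE : (z^T *m c) 0 0 = (c^T *m z) 0 0 by rewrite -[z^T *m c]trmxK mxE trmx_mul trmxK.
rewrite [(z + _)^T]linearD/= !mulmxDl !mulmxDr !addE.
rewrite trmx_mul trmx_inv_spd !mulmxA mulmxK// !mulmxKV// tE.
have := spd_ge0 z.
move: ((z^T *m M *m z) 0 0) ((c^T *m z) 0 0) ((c^T *m invmx M *m c) 0 0).
by move=> x y u; lra.
Qed.

End SymmetricPositiveDefinite.

(** * Curves of constant momentum *)

(** If [v] annihilated the increment, the mean value theorem for the scalar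
    function [v *m P t *m v^T] would produce a zero of a positive quantity. *)
Lemma primitive_increment_unitmx (R : realType) m (P V : R -> 'M[R]_m) :
  has_deriv01 P V ->
  (forall t (s : 'cV[R]_m), I01 t -> s != 0 -> 0 < (s^T *m V t *m s) 0 0) ->
  P 1 - P 0 \in unitmx.
Proof.
move=> PV pos; rewrite unitmxE unitfE; apply/det0P => -[v v0 vM].
have v0' : v^T != 0 by apply: contra v0 => /eqP h; rewrite -[v]trmxK h trmx0.
have := has_deriv01_entry (i := 0) (j := 0) (has_deriv01_mulmxr (C := v^T) (has_deriv01_mulmxl (C := v) PV)).
move=> /has_deriv01_MVT[c Ic].
have := pos c _ Ic v0'; rewrite trmxK => + E; rewrite -E.
have -> : forall X Y : 'M[R]_1, X 0 0 - Y 0 0 = (X - Y) 0 0 by move=> X Y; rewrite !mxE.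
by rewrite -mulmxBl -mulmxBr vM mul0mx mxE ltxx.
Qed.

Section WeightedNormAlongCurve.
Variables (R : realType) (m : nat) (W : R -> 'M[R]_m).
Hypothesis W_cont : {within I01, continuous W}.
Hypothesis W_spd : forall t : R, I01 t -> spd_mx (W t).

Lemma half_sqr_wnorm_within_continuous (s : R -> 'cV[R]_m) :
  {within I01, continuous s} ->
  {within I01, continuous (fun t => 2^-1 * wnorm (W t) (s t) ^+ 2)}.
Proof.
move=> /(within_quadratic W_cont)/within_cvg cq; apply/within_cvg => t It.
rewrite (sqr_wnorm (W_spd It)).
have : (fun t => 2^-1 * ((s t)^T *m W t *m s t) 0 0) @ within I01 (nbhs t) -->
    2^-1 * ((s t)^T *m W t *m s t) 0 0.
  by apply: cvgM; [exact: cvg_cst|exact: cq].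
apply: cvg_trans; apply: near_eq_cvg.
have : \forall s \near within I01 (nbhs t), I01 s by exact: withinT.
by apply: filterS => u Iu; rewrite (sqr_wnorm (W_spd Iu)).
Qed.

(** These are the extremals of the kinetic energy [2^-1 * wnorm (W t) (r' t) ^+ 2]:
    their momentum [W t *m r' t] is a constant [c], which can be adjusted to reach
    any endpoint because the integral of [invmx (W t)] is invertible. *)
Lemma constant_momentum_curve (D : 'cV[R]_m) :
  exists (c : 'cV[R]_m) (r : R -> 'cV[R]_m),
    [/\ has_deriv01 r (fun t => invmx (W t) *m c),
        {within I01, continuous (fun t => invmx (W t) *m c)},
        r 0 = 0 & r 1 = D].
Proof.
have Vc : {within I01, continuous (fun t => invmx (W t))}.
  by apply: invmx_within_continuous => // t It; exact: spd_unitmx (W_spd It).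
have [P PV] := mx_within_has_primitive Vc.
(* [P 1 - P 0] is the integral of the inverse weights. *)
have Mu : P 1 - P 0 \in unitmx.
  by apply: primitive_increment_unitmx PV _ => t s It; exact: inv_spd_gt0 (W_spd It) _.
pose c := invmx (P 1 - P 0) *m D.
exists c, (fun t => P t *m c + - (P 0 *m c)); split.
- have := has_deriv01D (has_deriv01_mulmxr (C := c) PV) (has_deriv01_cst (- (P 0 *m c))).
  by congr has_deriv01; apply/funext => t; rewrite addr0.
- apply: within_mulmx => //; apply/within_cvg => t It; exact: cvg_cst.
- by rewrite subrr.
- by rewrite -mulmxBl mulKVmx.
Qed.

End WeightedNormAlongCurve.

(** * Actions of admissible curves *)

Lemma admissible_intro (R : realType) n (x x' : R -> 'cV[R]_n) :
  has_deriv01 x x' -> {within I01, continuous x'} -> admissible x.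
Proof.
move=> xx' cx'; split; first by move=> t It; exact: has_deriv01_derivable xx' It.
apply: subspace_eq_continuous cx' => t; rewrite inE => It.
by rewrite /from_subspace (derive_inE xx' It).
Qed.

Lemma admissible_has_deriv01 (R : realType) n (x : R -> 'cV[R]_n) :
  admissible x -> has_deriv01 x (derive_in I01 x).
Proof. by move=> [dx _]; exact: derivable_in_has_deriv01. Qed.

Lemma actionE (R : realType) n (L : lagrangian n) (x x' : R -> 'cV[R]_n) :
  has_deriv01 x x' ->
  action L x = Rintegral lebesgue_measure I01 (fun t => L (x t) (x' t) t).
Proof.
move=> xx'; apply: eq_Rintegral => t; rewrite inE => It.
by rewrite /from_subspace (derive_inE xx' It).
Qed.

Lemma lagrangian_within_continuous (R : realType) n
    (L : 'cV[R]_n -> 'cV[R]_n -> R -> R) (x x' : R -> 'cV[R]_n) :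
  {within @lagrangian_dom R n, continuous (fun p => L p.1.1 p.1.2 p.2)} ->
  {within I01, continuous x} -> {within I01, continuous x'} ->
  {within I01, continuous (fun t => L (x t) (x' t) t)}.
Proof.
move=> /subspace_continuousP cL /within_cvg cx /within_cvg cx'.
apply/within_cvg => t It.
have Lt : @lagrangian_dom R n (x t, x' t, t) by split.
have c : (fun s => (x s, x' s, s)) @ within I01 (nbhs t) -->
    nbhs ((x t, x' t), t).
  exact: (cvg_pair (cvg_pair (cx t It) (cx' t It)) (@cvg_within _ (nbhs t) (nbhs_filter t) I01)).
have c2 : (fun s => (x s, x' s, s)) @ within I01 (nbhs t) -->
    within (@lagrangian_dom R n) (nbhs ((x t, x' t), t)).
  move=> A hA; have {}hA : \forall s \near within I01 (nbhs t),
    @lagrangian_dom R n (x s, x' s, s) -> A (x s, x' s, s) by exact: c _ hA.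
  have I : \forall s \near within I01 (nbhs t), I01 s by exact: withinT.
  have : \forall s \near within I01 (nbhs t), A (x s, x' s, s).
    by apply: filterS2 hA I => s h Is; exact: (h (conj Logic.I Is)).
  exact.
exact: (cvg_comp _ _ c2 (cL _ Lt)).
Qed.

Lemma drift_within_continuous (R : realType) (n m : nat)
    (A : 'cV[R]_n -> 'M[R]_(m, n)) (x x' : R -> 'cV[R]_n) : continuous A ->
  {within I01, continuous x} -> {within I01, continuous x'} ->
  {within I01, continuous (fun t => A (x t) *m x' t)}.
Proof.
move=> cA /within_cvg cx cx'; apply: within_mulmx cx'; apply/within_cvg => t It.
by move/cvg_comp: (cx t It); apply; exact: cA.
Qed.

Theorem theorem2 (R : realType) (n m : nat)
  (f : 'cV[R]_n -> 'cV[R]_n -> R -> R) (x0 x1 : 'cV[R]_n)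
  (f_C1 : C1_lagrangian f)
  (f_min : exists xs : R -> 'cV[R]_n,
     euler_lagrange f xs /\ global_minimizer f x0 x1 xs)
  (A : 'cV[R]_n -> 'M[R]_(m, n))
  (A_diff : forall x : 'cV[R]_n, differentiable A x)
  (A_closed : forall (x : 'cV[R]_n) (j : 'I_m) (i k : 'I_n),
     'D_(delta_mx k 0) (fun y => A y j i) x =
     'D_(delta_mx i 0) (fun y => A y j k) x)
  (W : R -> 'M[R]_m)
  (W_diff : forall t : R, I01 t -> derivable_in I01 W t)
  (W_spd : forall t : R, I01 t -> spd_mx (W t))
  (s0 s1 : 'cV[R]_m) :
  exists qs : R -> 'cV[R]_(n + m),
    global_minimizer (augmented f A W) (col_mx x0 s0) (col_mx x1 s1) qs.
Proof.
have [f_cont _ _ _ _] := f_C1.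
have [xs [_ [xs_adm xs0 xs1 xs_min]]] := f_min.
have A_cont : continuous A by move=> x; exact: differentiable_continuous.
have W_cont : {within I01, continuous W}.
  exact: has_deriv01_continuous (derivable_in_has_deriv01 W_diff).
have [S S_chain] := closed_matrix_has_potential A_diff A_closed.
have [c [r [r_deriv r'_cont r0 r1]]] :=
  constant_momentum_curve W_cont W_spd (s1 - s0 - (S x1 - S x0)).
pose Vc t := invmx (W t) *m c.
pose xs' := derive_in I01 xs.
have xs_deriv : has_deriv01 xs xs' := admissible_has_deriv01 xs_adm.
have xs_cont := has_deriv01_continuous xs_deriv.
have xs'_cont : {within I01, continuous xs'} by case: xs_adm.
(* In the coordinate [s - S x] the penalty is the kinetic energy alone, and there
   the optimal motion has constant momentum; the constant fixes the value at 0. *)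
pose ss t := S (xs t) + (r t + (s0 - S x0)).
pose ss' t := A (xs t) *m xs' t + (Vc t + 0).
have ss_deriv : has_deriv01 ss ss'.
  apply: has_deriv01D; first exact: S_chain.
  by apply: (has_deriv01D r_deriv); exact: has_deriv01_cst.
have ss'_cont : {within I01, continuous ss'}.
  apply: withinD; first exact: drift_within_continuous.
  by under eq_fun do rewrite addr0.
exists (fun t => col_mx (xs t) (ss t)).
have q_deriv := has_deriv01_col_mx xs_deriv ss_deriv.
split.
- exact: admissible_intro q_deriv (within_col_mx xs'_cont ss'_cont).
- by rewrite /ss xs0 r0 add0r addrC subrK.
- rewrite /ss xs1 r1; congr col_mx.
  by apply/matrixP => i j; rewrite !mxE; ring.
move=> y y_adm y0 y1.
have y_deriv := admissible_has_deriv01 y_adm.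
have [_ y'_cont] := y_adm.
set y' := derive_in I01 y in y_deriv y'_cont.
pose x t := usubmx (y t); pose x' t := usubmx (y' t).
pose s t := dsubmx (y t); pose s' t := dsubmx (y' t).
have x_deriv : has_deriv01 x x' := has_deriv01_usubmx y_deriv.
have s_deriv : has_deriv01 s s' := has_deriv01_dsubmx y_deriv.
have x_cont := has_deriv01_continuous x_deriv.
have x'_cont : {within I01, continuous x'} := within_usubmx y'_cont.
have s'_cont : {within I01, continuous s'} := within_dsubmx y'_cont.
have xy0 : x 0 = x0 by rewrite /x y0 col_mxKu.
have xy1 : x 1 = x1 by rewrite /x y1 col_mxKu.
have sy0 : s 0 = s0 by rewrite /s y0 col_mxKd.
have sy1 : s 1 = s1 by rewrite /s y1 col_mxKd.
have J_le : action f xs <= action f x.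
  exact: (xs_min x (admissible_intro x_deriv x'_cont) xy0 xy1).
(* [kin] is the optimal penalty, [w] the velocity of [s - S x] for the competitor,
   and [lin] the first variation of the penalty towards the competitor. *)
pose kin t := 2^-1 * wnorm (W t) (Vc t) ^+ 2.
pose w t := s' t - A (x t) *m x' t.
pose lin t := (c^T *m (w t - Vc t)) 0 0.
have Vc_cont : {within I01, continuous Vc} := r'_cont.
have kin_cont : {within I01, continuous kin}.
  exact: half_sqr_wnorm_within_continuous.
have w_cont : {within I01, continuous w}.
  exact: withinB s'_cont (drift_within_continuous A_cont x_cont x'_cont).
have lin_cont : {within I01, continuous lin}.
  apply: (within_mx_entries _ _).1 0 0; apply: within_mulmx (withinB w_cont Vc_cont).
  by apply/within_cvg => t It; exact: cvg_cst.
(* [lin] is the derivative of [c^T *m (s - S x - r)], which takes the same value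
   at both ends because both curves satisfy the same boundary conditions. *)
have lin_int0 : Rintegral lebesgue_measure I01 lin = 0.
  have g_deriv : has_deriv01 (fun t => c^T *m (s t - S (x t) - r t))
      (fun t => c^T *m (w t - Vc t)).
    apply: has_deriv01_mulmxl; apply: has_deriv01B r_deriv.
    by apply: (has_deriv01B s_deriv); exact: S_chain.
  rewrite (has_deriv01_FTC (has_deriv01_entry (i := 0) (j := 0) g_deriv) lin_cont).
  rewrite xy0 xy1 sy0 sy1 r0 r1 subr0.
  have -> : s1 - S x1 - (s1 - s0 - (S x1 - S x0)) = s0 - S x0.
    by apply/matrixP => i j; rewrite !mxE; ring.
  by rewrite subrr.
rewrite (actionE _ q_deriv) (actionE _ y_deriv).
have -> : Rintegral lebesgue_measure I01 (fun t => augmented f A W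
    (col_mx (xs t) (ss t)) (col_mx (xs' t) (ss' t)) t) =
    action f xs + Rintegral lebesgue_measure I01 kin.
  rewrite /action -(Rintegral01D
    (lagrangian_within_continuous f_cont xs_cont xs'_cont) kin_cont).
  apply: eq_Rintegral => t _; rewrite /augmented !col_mxKu !col_mxKd.
  by rewrite /ss' addr0 addrAC subrr add0r.
apply: (@le_trans _ _ (action f x + Rintegral lebesgue_measure I01 kin +
    Rintegral lebesgue_measure I01 lin)).
  by rewrite lin_int0 addr0 lerD2r.
have fx_cont := lagrangian_within_continuous f_cont x_cont x'_cont.
have fxk_cont := withinD (V := R^o) fx_cont kin_cont.
rewrite (actionE f x_deriv) -(Rintegral01D fx_cont kin_cont).
rewrite -(Rintegral01D fxk_cont lin_cont).
apply: le_Rintegral01.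
- exact: (withinD (V := R^o) fxk_cont lin_cont).
- exact: (withinD (V := R^o) fx_cont
    (half_sqr_wnorm_within_continuous W_cont W_spd w_cont)).
move=> t It; rewrite /augmented -addrA lerD2l /kin /lin.
have half (a b d : R) : a + 2 * d <= b -> 2^-1 * a + d <= 2^-1 * b.
  by clear; lra.
exact: half (sqr_wnorm_tangent (W_spd _ It) c (w t)).
Qed.
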